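(* There is a function $\delta:\mathbb{N}\to[0,1]$ with $n\,\delta(n)\to 0$ as $n\to\infty$ such that the following holds. Suppose that $G$ is an $n$-vertex $(\varepsilon,s)$-expander with $2^{-9}\le \varepsilon\le 1$ and $s\ge 2\log^{24} n$. Let $V\subseteq V(G)$ be a random subset chosen by including each vertex independently at random with probability $\frac13$. Then, with probability at least $1-\delta(n)$ (i.e. $1-o(1/n)$), for every non-empty $U\subseteq V(G)$ and every set $F\subseteq E(G)$ with $|F|\le \frac{|U|}{\log^{27} n}$, $$|B_{G-F}^{\log^4 n}(U,V)|>\frac{|V|}{2}.$$
   Context: Graphs are finite and simple; logarithms have base two and $\log^k n=(\log n)^k$. For a graph $G$ and $F\subseteq E(G)$, $G-F$ is $G$ with the edges of $F$ deleted. $N_G(U)$ is the set of vertices in $V(G)\setminus U$ with a neighbour in $U$. An $n$-vertex graph $G$ is an $(\varepsilon,s)$-expander if, for every $U\subseteq V(G)$ and $F\subseteq E(G)$ with $1\le|U|\le\frac23 n$ and $|F|\le s|U|$, we have $|N_{G-F}(U)|\ge \frac{\varepsilon|U|}{\log^2 n}$. A path through a vertex set $V$ is a path all of whose internal vertices lie in $V$ (its endvertices need not be in $V$). For $U,V\subseteq V(G)$ and $r\ge 0$, $B^{r}_G(U,V)$ is the set of vertices in $V$ which can be reached by a path in $G$ through $V$ of length at most $r$ starting from a vertex of $U$ (the starting vertex need not be in $V$; paths of length $0$ are allowed). *)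

(* Defs.v *)
From HB Require Import structures.
From mathcomp Require Import all_boot all_order all_algebra.
From mathcomp Require Import boolp reals topology normedtype sequences exp.

Set Implicit Arguments.
Unset Strict Implicit.
Unset Printing Implicit Defensive.

Import Order.TTheory GRing.Theory Num.Theory.
Local Open Scope ring_scope.

Record sgraph := SGraph {
  svertex :> finType;
  adj : rel svertex;
  adj_sym : symmetric adj;
  adj_irrefl : irreflexive adj }.

Definition edges (G : sgraph) : {set {set G}} :=
  [set [set p.1; p.2] | p in [pred p : G * G | adj p.1 p.2]].

Section DeleteEdges.
Variables (G : sgraph) (F : {set {set G}}).

Definition del_adj : rel G := fun x y => adj x y && ([set x; y] \notin F).

Lemma del_adj_sym : symmetric del_adj.
Proof. by move=> x y; rewrite /del_adj adj_sym setUC. Qed.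

Lemma del_adj_irrefl : irreflexive del_adj.
Proof. by move=> x; rewrite /del_adj adj_irrefl. Qed.

Definition del_edges : sgraph := SGraph del_adj_sym del_adj_irrefl.
End DeleteEdges.

Definition neighbours (G : sgraph) (U : {set G}) : {set G} :=
  [set y in ~: U | [exists x in U, adj x y]].

(* A path from x is given by the sequence p of its vertices after x, so that
   its length is [size p] and its end is [last x p]. *)
Definition is_path (G : sgraph) (x : G) (p : seq G) : bool :=
  path (@adj G) x p && uniq (x :: p).

(* [belast x p] drops the last vertex and [behead] the first one. *)
Definition internal (G : sgraph) (x : G) (p : seq G) : seq G :=
  behead (belast x p).

Section Real.
Variable R : realType.

Definition log2 (x : R) : R := ln x / ln 2.

Definition expander (G : sgraph) (eps s : R) : Prop :=
  forall (U : {set G}) (F : {set {set G}}),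
    F \subset edges G ->
    (1 <= #|U|)%N -> #|U|%:R <= 2 / 3 * #|G|%:R :> R ->
    #|F|%:R <= s * #|U|%:R ->
    eps * #|U|%:R / log2 #|G|%:R ^+ 2
      <= #|neighbours (G := del_edges F) U|%:R.

Definition ball_through (G : sgraph) (r : R) (U V : {set G}) : {set G} :=
  [set y in V | `[< exists (x : G) (p : seq G),
      [/\ x \in U, is_path x p, last x p = y,
          {subset internal x p <= V} & (size p)%:R <= r] >]].

(* The probability that a random subset of T, containing each element
   independently with probability q, satisfies A. *)
Definition prob_subset (T : finType) (q : R) (A : {set T} -> Prop) : R :=
  \sum_(V : {set T} | `[< A V >])
    \prod_(v : T) (if v \in V then q else 1 - q).

End Real.

(* Main.v *)
(* Let n = |G| and l ~ log n, and say that a vertex is reached if a path through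
   V leads to it from U; the vertex itself need not be in V.
   If A is the set of vertices reached so far and S' is a maximal subset of
   A /\ V whose neighbours outside A number at least K |S'|, then a vertex of A
   with K or more neighbours outside A \/ N(S') is "blocked" and, by maximality,
   lies outside V.  The other vertices of A send at most K |A| <= s |A| / 2 edges
   out of A \/ N(S'), so deleting these edges and applying the expansion property
   shows that either N(S') enlarges A by a factor 1 + Omega(1 / l^2), or there
   are Omega(|A| / l^2) blocked vertices.  The second case is unlikely: A and the
   blocked set are determined by sampled sets of total size O(|A| / l^20)
   together with F, so a union bound over these data beats the probability
   (2/3)^(number of blocked vertices).  The same step with V replaced by the whole
   vertex set replaces U by some U' with |N(U')| >= K |U'|, which makes the union
   bound over U' affordable.  After O(l^3) rounds |A| > 2n/3, and a second union
   bound shows that V meets A more than it meets the complement of A. *)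
Require Import Defs.
From HB Require Import structures.
From mathcomp Require Import all_boot all_order all_algebra.
From mathcomp Require Import boolp reals topology normedtype sequences exp.
From mathcomp Require Import zify ring lra finset.

Set Implicit Arguments.
Unset Strict Implicit.
Unset Printing Implicit Defensive.

Import Order.TTheory GRing.Theory Num.Theory numFieldNormedType.Exports.

(** * Reached and blocked vertices *)

(** Unlike [neighbours], members of [A] are kept, so that [nb e] is monotone and distributes over
    unions. *)
Definition nb (T : finType) (e : rel T) (A : {set T}) : {set T} :=
  [set y | [exists x in A, e x y]].

(* The vertices reached from U within i + 1 steps when all internal vertices
   lie in S. *)
Definition layer (T : finType) (e : rel T) (U S : {set T}) (i : nat) : {set T} :=
  iter i (fun A => A :|: nb e (A :&: S)) (U :|: nb e U).

(** The count is a marginal gain: the number of vertices that adding [a] to [S] would add to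
    [nb e S :\: A]. *)
Definition blocked (T : finType) (e : rel T) (K : nat) (A S : {set T}) : {set T} :=
  [set a in A | K <= #|nb e [set a] :\: (A :|: nb e S)|].

Lemma nbP (T : finType) (e : rel T) (A : {set T}) y :
  reflect (exists2 x, x \in A & e x y) (y \in nb e A).
Proof. by rewrite inE; apply: exists_inP. Qed.

Lemma nbS (T : finType) (e : rel T) (A B : {set T}) :
  A \subset B -> nb e A \subset nb e B.
Proof.
move=> AB; apply/subsetP => y /nbP[x xA exy].
by apply/nbP; exists x => //; apply: (subsetP AB).
Qed.

Lemma nbU (T : finType) (e : rel T) (A B : {set T}) :
  nb e (A :|: B) = nb e A :|: nb e B.
Proof.
apply/setP => y; rewrite in_setU; apply/nbP/orP => [[x /setUP[xA|xB] exy]|].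
- by left; apply/nbP; exists x.
- by right; apply/nbP; exists x.
- by case=> /nbP[x xA exy]; exists x; rewrite // inE xA ?orbT.
Qed.

Lemma nb0 (T : finType) (e : rel T) : nb e set0 = set0.
Proof. by apply/setP => y; rewrite in_set0; apply/nbP => -[x]; rewrite inE. Qed.

Lemma layerS (T : finType) (e : rel T) (U S S' : {set T}) i :
  S \subset S' -> layer e U S i \subset layer e U S' i.
Proof.
move=> SS'; elim: i => [|i IH] //=.
by apply: setUSS => //; apply: nbS; apply: setISS.
Qed.

(** Take [S] of maximal size under the first two conditions. A blocked vertex of [V] is not in [S],
    as its gain is positive, and adding it would keep both conditions. *)
Lemma maximal_sampling (T : finType) (e : rel T) (K : nat) (A V : {set T}) :
  0 < K ->
  exists S : {set T}, [/\ S \subset A :&: V, K * #|S| <= #|nb e S :\: A|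
    & [disjoint blocked e K A S & V]].
Proof.
move=> K0.
pose P := [pred S : {set T} | (S \subset A :&: V) && (K * #|S| <= #|nb e S :\: A|)].
have P0 : P set0 by rewrite /= sub0set cards0 muln0.
case: (@arg_maxnP _ set0 P (fun S => #|S|) P0) => S /andP[SV KS] Smax.
exists S; split=> //; apply/pred0P => a /=; apply/negbTE/negP => /andP[].
rewrite inE => /andP[aA Ka] aV.
have aS : a \notin S.
  apply/negP => aS.
  suff : nb e [set a] :\: (A :|: nb e S) = set0 by move=> E; move: Ka; rewrite E cards0; lia.
  apply/eqP; rewrite setD_eq0 subsetU // nbS ?orbT //.
  by rewrite sub1set.
have /Smax : P (a |: S).
  rewrite /= subUset sub1set in_setI aA aV SV /= cardsU1 aS nbU setDUl.
  have -> : nb e [set a] :\: A :|: nb e S :\: A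
      = (nb e [set a] :\: (A :|: nb e S)) :|: (nb e S :\: A).
    by apply/setP => y; rewrite !in_setU !in_setD !in_setU; case: (y \in A); case: (y \in nb e S); rewrite //= ?orbT ?orbF.
  rewrite cardsU.
  have -> : (nb e [set a] :\: (A :|: nb e S)) :&: (nb e S :\: A) = set0.
    by apply/setP => y; rewrite !inE; case: (y \in A); case: [exists _ in S, _]; rewrite ?andbF.
  rewrite cards0; lia.
by rewrite /= cardsU1 aS; lia.
Qed.

(** * One step of expansion *)

(** Here [2 * M] stands for [s], and [h] for log^2 n / eps rounded up. *)
Definition nat_expander (G : sgraph) (M h : nat) : Prop :=
  forall (U : {set G}) (F : {set {set G}}), F \subset edges G ->
    0 < #|U| -> 3 * #|U| <= 2 * #|G| -> #|F| <= 2 * M * #|U| ->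
    #|U| <= h * #|neighbours (G := del_edges F) U|.

Lemma leq_card_bigcup (I T : finType) (P : pred I) (B : I -> {set T}) :
  #|\bigcup_(i | P i) B i| <= \sum_(i | P i) #|B i|.
Proof.
elim/big_rec2: _ => [|i m A _ IH]; first by rewrite cards0.
by rewrite (leq_trans (leq_card_setU _ _)) // leq_add2l.
Qed.

(** Expansion is applied to the unblocked part [A :\: D], with [F] and the edges [F'] from it to the
    outside of [A :|: nb e S] deleted. Only [D] and [nb e S :\: A] can supply the remaining
    neighbours. *)
Lemma expansion_or_blocked (G : sgraph) (M h K : nat) (F : {set {set G}})
    (A S : {set G}) :
  nat_expander G M h -> K < M -> F \subset edges G ->
  0 < #|A| -> 3 * #|A| <= 2 * #|G| -> #|F| <= #|A| ->
  #|A| <= 4 * h * #|nb (del_adj F) S :\: A|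
    \/ #|A| <= 4 * h * #|blocked (del_adj F) K A S|.
Proof.
move=> Gexp KM FE A0 A3 FA.
set e := del_adj F; set B := A :|: nb e S; set D := blocked e K A S.
have DA : D \subset A by apply/subsetP => x; rewrite inE => /andP[].
have cDA := cardsDS DA; have cD := subset_leq_card DA.
pose F' := \bigcup_(a in A :\: D) [set [set a; b] | b in nb e [set a] :\: B].
have F'E : F' \subset edges G.
  apply/bigcupsP => a _; apply/subsetP => f /imsetP[b].
  rewrite inE => /andP[_ /nbP[x /set1P ->]] /andP[ab _] ->.
  by apply/imsetP; exists (a, b).
have F'c : #|F'| <= K * #|A|.
  apply: leq_trans (leq_card_bigcup _ _) _.
  apply: (@leq_trans (\sum_(a in A :\: D) K)); last first.
    by rewrite sum_nat_const mulnC leq_mul2l subset_leq_card ?orbT // subsetDl.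
  apply: leq_sum => a; rewrite inE => /andP[aD aA].
  apply: leq_trans (leq_imset_card _ _) _; rewrite leqNgt; apply: contra aD => /ltnW KB.
  by rewrite inE aA.
case: (leqP #|A| (4 * h * #|D|)) => [|hD]; first by right.
left.
case: (posnP h) => [h0|h0].
  have := Gexp A set0; rewrite sub0set cards0 A0 A3 h0 mul0n => /(_ isT isT isT isT); lia.
case: (posnP #|A :\: D|) => [AD0|AD0]; first by nia.
(* Deletions cost at most [(K + 1) * #|A|], and few blocked vertices leave at least half of [A];
   hence the 2 in [2 * M]. *)
have FF : #|F :|: F'| <= 2 * M * #|A :\: D|.
  have FF' : #|F :|: F'| <= M * #|A|.
    apply: leq_trans (leq_card_setU _ _) _; apply: leq_trans (leq_add FA F'c) _.
    by rewrite -mulSn leq_mul2r KM orbT.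
  have D2 : #|A| <= 2 * #|A :\: D| by nia.
  by rewrite mulnAC mulnC; apply: leq_trans FF' _; rewrite leq_mul2l D2 orbT.
have := Gexp (A :\: D) (F :|: F').
rewrite subUset FE F'E AD0 => /(_ isT isT) H.
have {}H := H _ FF.
have {}H : #|A :\: D| <= h * #|neighbours (G := del_edges (F :|: F')) (A :\: D)|.
  by apply: H; lia.
have sub : neighbours (G := del_edges (F :|: F')) (A :\: D) \subset D :|: (nb e S :\: A).
  apply/subsetP => y; rewrite inE in_setC in_setD negb_and negbK.
  move=> /andP[yAD /exists_inP[x xAD]] /andP[xy].
  rewrite in_setU negb_or => /andP[xyF xyF']; rewrite in_setU in_setD.
  have [yA|yA] := boolP (y \in A); first by move: yAD; rewrite yA orbF => ->.
  have [yS|yS] := boolP (y \in nb e S); first by rewrite orbT.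
  case/negP: xyF'; apply/bigcupP; exists x => //; apply/imsetP; exists y => //.
  rewrite in_setD in_setU negb_or yA yS; apply/nbP; exists x; rewrite ?inE //.
  by rewrite /e /del_adj xy xyF.
have := leq_trans (subset_leq_card sub) (leq_card_setU _ _).
set x := #|_ :\: A|; rewrite -/x -(leq_pmul2l h0) mulnDr => H'.
have Dh : #|D| <= h * #|D| by rewrite leq_pmull.
rewrite -mulnA; rewrite -mulnA in hD; move: (leq_trans H H'); rewrite cDA; move: (h * #|D|) (h * x) Dh hD cD => u v; move: #|A| #|D| => a d; lia.
Qed.


(** * From layers to paths *)

(** Shortening a walk to a simple path keeps its end [y], which by uniqueness is not internal; so
    the internal vertices come from [q], even if [y] lies outside [V]. *)
Lemma path_shorten (G : sgraph) (U V : {set G}) (q : seq G) x y r :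
  x \in U -> path (@adj G) x (rcons q y) -> {subset q <= V} -> size q < r ->
  exists (z : G) (p : seq G), [/\ z \in U, is_path z p, last z p = y,
    {subset internal z p <= V} & size p <= r].
Proof.
move=> xU + qV sq; move E: (rcons q y) => p0 pp.
have lp : last x p0 = y by rewrite -E last_rcons.
case/shortenP: pp lp => p' pp' up' sub lp.
exists x, p'; split=> //; first by rewrite /is_path pp' up'.
  move=> z; case/lastP: p' pp' up' sub lp => [|p' w] //=.
  rewrite last_rcons /internal belast_rcons /= => _ /andP[_ up] sub wy zp.
  have : z \in p0 by apply: sub; rewrite mem_rcons inE zp orbT.
  rewrite -E mem_rcons inE => /orP[/eqP zy|]; last exact: qV.
  by move: up; rewrite rcons_uniq wy -zy zp.
apply: leq_trans sq; rewrite -(size_rcons q y) E.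
by apply: uniq_leq_size => //; case/andP: up'.
Qed.

Lemma layer_path (G : sgraph) (F : {set {set G}}) (U0 U S V : {set G}) i y :
  U0 \subset U -> S \subset V -> y \in layer (del_adj F) U0 S i ->
  exists (x : del_edges F) (p : seq (del_edges F)), [/\ x \in U, is_path x p, last x p = y,
    {subset internal x p <= V} & size p <= i.+1].
Proof.
move=> UU SV yi.
(* The induction carries walks, since extending a simple path may repeat a vertex. *)
suff [yU|[x [q [xU pq qV sq]]]] : y \in U0 \/ exists x q, [/\ x \in U0,
    path (del_adj F) x (rcons q y), {subset q <= V} & size q <= i].
- by exists y, [::]; split=> //; apply: (subsetP UU).
- by apply: (@path_shorten (del_edges F) U V q x) => //; apply: (subsetP UU).
elim: i y yi => [|i IH] y /=.
  case/setUP => [|/nbP[x xU xy]]; first by left.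
  by right; exists x, [::]; split=> //=; rewrite xy.
case/setUP => [/IH [|[x [q [xU pq qV sq]]]]|/nbP[x /setIP[/IH xi xS] xy]].
- by left.
- by right; exists x, q; split=> //; apply: leqW.
right; case: xi => [xU|[z [q [zU pq qV sq]]]].
  by exists x, [::]; split=> //=; rewrite xy.
exists z, (rcons q x); split=> //.
- by rewrite rcons_path pq last_rcons.
- move=> w; rewrite mem_rcons inE => /orP[/eqP ->|/qV //].
  exact: (subsetP SV).
- by rewrite size_rcons ltnS.
Qed.

(* S is the part of V used to reach A, and S' the sampled part of A used in the
   next round; (U, F, S, S', i) ranges over the union bound. *)
Definition bad_sample (G : sgraph) (h K : nat) (U : {set G}) (F : {set {set G}})
    (S S' : {set G}) (i : nat) (V : {set G}) : bool :=
  let A := layer (del_adj F) U S i in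
  let D := blocked (del_adj F) K A S' in
  [&& F \subset edges G, K * #|U| <= #|A|, K * #|F| <= #|A|, K * #|S| <= #|A|,
      K * #|S'| <= #|A|, K <= #|A| &
      (#|A| <= 4 * h * #|D|) && [disjoint D & V]
      || (2 * #|G| < 3 * #|A|) && (#|V :&: A| <= #|V :\: A|)].

(** * Geometric growth of the layers *)

(** Bernoulli's inequality gives (1 + 1/a)^a >= 2, here cleared of denominators. *)
Lemma pow2_mul_expn_leq a k : 0 < a -> 2 ^ k * a ^ (a * k) <= a.+1 ^ (a * k).
Proof.
move=> a0; have bernoulli m : a ^ m * (a + m) <= a.+1 ^ m * a.
  elim: m => [|m IH]; first by rewrite !expn0 addn0.
  rewrite !expnS -[leqRHS]mulnA; apply: leq_trans (leq_mul (leqnn a.+1) IH).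
  by rewrite mulnCA (mulnC a) -mulnA leq_mul2l; apply/orP; right; nia.
rewrite !expnM -expnMn; case: k => // k; rewrite leq_exp2r //.
have := bernoulli a; rewrite addnn -muln2 mulnA (mulnC _ 2) mulnA leq_pmul2r //.
Qed.

(** Each round adds a maximal sampled set [S'] to [S]. Since [K * #|S'|] is at most the number of
    new vertices, [K * #|S| <= #|A S j|] persists by telescoping. Every round gains a vertex, so
    round indices stay below [#|G|]. *)
Lemma layer_growth (G : sgraph) (M h K : nat) (F : {set {set G}}) (U V : {set G}) i :
  let A S j := layer (del_adj F) U S j in
  let A0 := A set0 0 in
  nat_expander G M h -> 0 < h -> 0 < K < M -> F \subset edges G ->
  K * #|U| <= #|A0| -> K * #|F| <= #|A0| -> K <= #|A0| ->
  (forall S S' j, j < #|G| -> ~~ bad_sample h K U F S S' j V) ->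
  exists (S : {set G}) (j : nat), j <= i /\ [/\ S \subset V, K * #|S| <= #|A S j|, #|A0| <= #|A S j|, j < #|A S j|
    & 2 * #|G| < 3 * #|A S j| \/ j = i /\ (4 * h).+1 ^ i <= (4 * h) ^ i * #|A S j|].
Proof.
move=> A A0 Gexp h0 /andP[K0 KM] FE KU KF KA0 good.
elim: i => [|i [S [j [ji [SV KS A0A jA [big|[Eji grow]]]]]]].
- exists set0, 0; rewrite sub0set cards0 muln0 !leqnn (leq_trans K0 KA0); do 2!split=> //.
  by right; rewrite !expn0 mul1n (leq_trans K0 KA0).
- by exists S, j; split; [exact: leqW|split=> //; left].
subst j.
have [A3|A3] := ltnP (2 * #|G|) (3 * #|A S i|).
  by exists S, i; do 2!split=> //; left.
have [S' [S'V KS' dis]] := maximal_sampling (del_adj F) (A S i) V K0.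
have FA : #|F| <= #|A S i| by rewrite (leq_trans _ A0A) // (leq_trans _ KF) // leq_pmull.
have Apos : 0 < #|A S i| by rewrite (leq_trans _ A0A) // (leq_trans K0).
have AG : #|A S i| <= #|G| by apply: max_card.
have growth : #|A S i| <= 4 * h * #|nb (del_adj F) S' :\: A S i|.
  rewrite leqNgt; apply/negP => few.
  have [|bl] := @expansion_or_blocked G M h K F (A S i) S' Gexp KM FE Apos A3 FA.
    by rewrite leqNgt few.
  case/negP: (good S S' i (leq_trans jA AG)); rewrite /bad_sample /= -/(A S i).
  rewrite FE (leq_trans KU) // (leq_trans KF) // KS (leq_trans KA0) // bl dis !andbT /=.
  (* If growth fails, fewer than [#|A S i|] vertices are new, which bounds [K * #|S'|]. *)
  by apply: leq_trans KS' _; apply: ltnW; apply: leq_ltn_trans few; rewrite leq_pmull // muln_gt0.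
(* Enlarging [S] only enlarges earlier layers, so [S'] is still reached by round [i] and its
   neighbours by the next. *)
have sub : A S i :|: nb (del_adj F) S' \subset A (S :|: S') i.+1.
  have AS : A S i \subset A (S :|: S') i by apply: layerS; apply: subsetUl.
  rewrite /A /=; apply: setUSS => //; apply: nbS.
  by rewrite subsetI subsetUr andbT (subset_trans _ AS) // (subset_trans S'V) // subsetIl.
have {sub} card : #|A S i| + #|nb (del_adj F) S' :\: A S i| <= #|A (S :|: S') i.+1|.
  apply: leq_trans (subset_leq_card sub).
  rewrite (_ : _ :|: _ = A S i :|: (nb (del_adj F) S' :\: A S i)); last first.
    by apply/setP => y; rewrite !in_setU in_setD; case: (y \in A S i).
  rewrite cardsU (_ : _ :&: _ = set0) ?cards0 ?subn0 //.
  by apply/setP => y; rewrite in_setI in_setD in_set0; case: (y \in A S i).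
have pos : 0 < #|nb (del_adj F) S' :\: A S i| by rewrite lt0n; apply: contraTneq growth => ->; rewrite muln0 -ltnNge.
exists (S :|: S'), i.+1; split=> //; split.
- by rewrite subUset SV (subset_trans S'V) // subsetIr.
- apply: leq_trans card; apply: leq_trans (leq_mul (leqnn K) (leq_card_setU S S')) _.
  by rewrite mulnDr leq_add.
- by apply: leq_trans A0A (leq_trans (leq_addr _ _) card).
- by apply: leq_trans card; rewrite -addn1; apply: leq_add.
right; split=> //; rewrite !expnS -mulnA.
apply: leq_trans (leq_mul (leqnn _) grow) _.
rewrite mulnCA (mulnCA (4 * h)) leq_mul2l; apply/orP; right.
apply: leq_trans (leq_mul (leqnn _) card).
by rewrite mulSn addnC mulnDr leq_add2l.
Qed.

Lemma exists_subset_card (T : finType) (A : {set T}) k :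
  k <= #|A| -> exists2 B : {set T}, B \subset A & #|B| = k.
Proof.
move=> kA; exists [set:: take k (enum A)].
  by apply/subsetP => x; rewrite inE => /mem_take; rewrite mem_enum.
rewrite cardsE (card_uniqP (take_uniq _ (enum_uniq _))) size_take -cardE.
by case: ltngtP kA.
Qed.

Lemma good_sample_expands (G : sgraph) (M h K k : nat) (F : {set {set G}}) (U V : {set G}) :
  nat_expander G M h -> 0 < h -> 0 < K < M -> F \subset edges G -> U != set0 ->
  1 < #|G| -> #|G| < 2 ^ k -> 8 * h * K * #|F| <= #|U| ->
  (forall U' S S' j, j < #|G| -> ~~ bad_sample h K U' F S S' j V) ->
  exists A : {set G}, #|V :\: A| < #|V :&: A| /\
    forall y, y \in A -> exists (x : del_edges F) (p : seq (del_edges F)),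
      [/\ x \in U, is_path x p, last x p = y,
          {subset internal x p <= V} & size p <= (4 * h * k).+1].
Proof.
move=> Gexp h0 KM FE U0 n1 nk FU good; have /andP[K0 KM'] := KM.
(* Expansion needs at most 2n/3 vertices, so [U] is trimmed to [B], losing at most a factor 2. *)
have [B BU cB] := @exists_subset_card _ U (minn #|U| (2 * #|G| %/ 3)) (geq_minl _ _).
have U0' : 0 < #|U| by rewrite card_gt0.
have UG : #|U| <= #|G| by apply: max_card.
have B0 : 0 < #|B| by rewrite cB; lia.
have B3 : 3 * #|B| <= 2 * #|G| by rewrite cB; lia.
have UB : #|U| <= 2 * #|B| by rewrite cB; lia.
have FB4 : 4 * h * (K * #|F|) <= #|B| by rewrite -(leq_pmul2l (isT : 0 < 2)) (leq_trans _ UB) // (leq_trans _ FU) // !mulnA.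
have FB : #|F| <= #|B|.
  by apply: leq_trans FB4; rewrite mulnA leq_pmull // !muln_gt0 h0.
(* The endvertices in [U] may lie outside [V], so this round samples from [setT]; then no vertex is
   blocked and growth is certain. *)
have [U' [U'B KU' dis]] := maximal_sampling (del_adj F) B setT K0.
have start : #|B| <= 4 * h * #|nb (del_adj F) U' :\: B|.
  have [//|] := @expansion_or_blocked G M h K F B U' Gexp KM' FE B0 B3 FB.
  move: dis; rewrite disjoints_subset setCT subset0 => /eqP ->.
  by rewrite cards0 muln0 leqNgt B0.
rewrite setIT in U'B.
have A0 : #|nb (del_adj F) U' :\: B| <= #|layer (del_adj F) U' set0 0|.
  by apply: subset_leq_card; rewrite (subset_trans (subsetDl _ _)) //; apply: subsetUr.
have U'0 : 0 < #|U'|.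
  rewrite card_gt0; apply: contraTneq start => ->.
  by rewrite nb0 set0D cards0 muln0 -ltnNge.
have h4 : 0 < 4 * h by rewrite muln_gt0.
have KF : K * #|F| <= #|layer (del_adj F) U' set0 0|.
  by apply: leq_trans A0; rewrite -(leq_pmul2l h4) (leq_trans FB4).
have KU := leq_trans KU' A0.
have K1 : K <= #|layer (del_adj F) U' set0 0| by rewrite (leq_trans _ KU) // leq_pmulr.
have [S [j [ji [SV KS A0A jA grow]]]] :=
  @layer_growth G M h K F U' V (4 * h * k) Gexp h0 KM FE KU KF K1 (good U').
have big : 2 * #|G| < 3 * #|layer (del_adj F) U' S j|.
  (* Growing by a factor 1 + 1/(4h) for all [4 * h * k] rounds would give at least [2 ^ k] vertices,
     more than [#|G|]. *)
  case: grow => // -[-> grow]; exfalso.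
  have := leq_trans (pow2_mul_expn_leq k h4) grow.
  rewrite mulnC leq_pmul2l ?expn_gt0 ?h4 // => /leq_trans /(_ (max_card _)).
  by rewrite leqNgt nk.
exists (layer (del_adj F) U' S j); split.
  rewrite ltnNge; apply: contra (good U' S set0 j (leq_trans jA (max_card _))) => few.
  rewrite /bad_sample FE (leq_trans KU) // (leq_trans KF) // KS cards0 muln0 (leq_trans K1) //.
  by rewrite big few orbT.
move=> y /(layer_path (subset_trans U'B BU) SV)[x [p [xU xp lp pV sp]]].
by exists x, p; split=> //; apply: leq_trans sp _.
Qed.

(** * Random subsets *)

Local Open Scope classical_set_scope.
Local Open Scope ring_scope.

Definition weight (R : realType) (T : finType) (q : R) (V : {set T}) : R :=
  \prod_(v : T) (if v \in V then q else 1 - q).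

Lemma weight_ge0 (R : realType) (T : finType) (q : R) (V : {set T}) :
  0 <= q <= 1 -> 0 <= weight q V.
Proof. by move=> /andP[q0 q1]; apply: prodr_ge0 => v _; case: ifP => // _; rewrite subr_ge0. Qed.

(** Independence: the expectation of a product with one factor per vertex is the product of the
    expectations. *)
Lemma sum_weight_prod (R : realType) (T : finType) (q : R) (f g : T -> R) :
  \sum_(V : {set T}) weight q V * \prod_v (if v \in V then f v else g v)
    = \prod_v (q * f v + (1 - q) * g v).
Proof.
rewrite bigA_distr; apply: eq_bigr => V _; rewrite -big_split /=.
by apply: eq_bigr => v _; case: ifP.
Qed.

Lemma sum_weight (R : realType) (T : finType) (q : R) :
  \sum_(V : {set T}) weight q V = 1.
Proof.
transitivity (\prod_(v : T) (q * 1 + (1 - q) * 1)).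
  rewrite -sum_weight_prod; apply: eq_bigr => V _.
  by rewrite (eq_bigr (fun=> 1)) ?big1_eq ?mulr1 // => v _; case: ifP.
by rewrite big1 // => v _; rewrite !mulr1 addrCA subrr addr0.
Qed.

(** Markov's inequality for a test function that is a product over the vertices. *)
Lemma sum_weight_markov (R : realType) (T : finType) (q : R) (P : pred {set T}) (f g : T -> R) :
  0 <= q <= 1 -> (forall v, 0 <= f v) -> (forall v, 0 <= g v) ->
  (forall V : {set T}, P V -> 1 <= \prod_v (if v \in V then f v else g v)) ->
  \sum_(V : {set T} | P V) weight q V <= \prod_v (q * f v + (1 - q) * g v).
Proof.
move=> q01 f0 g0 PV; rewrite -sum_weight_prod [leRHS](bigID P) /=.
rewrite -[leLHS]addr0 lerD //.
  by apply: ler_sum => V /PV; apply: ler_peMr; apply: weight_ge0.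
apply: sumr_ge0 => V _; rewrite mulr_ge0 ?weight_ge0 //.
by apply: prodr_ge0 => v _; case: ifP.
Qed.

Lemma prod_if_mem (R : realType) (T : finType) (A : {set T}) (a b : R) :
  \prod_v (if v \in A then a else b) = a ^+ #|A| * b ^+ #|~: A|.
Proof.
rewrite (bigID (mem A)) /= (eq_bigr (fun=> a)); last by move=> v ->.
rewrite [X in _ * X](eq_bigr (fun=> b)); last by move=> v /negbTE ->.
rewrite !big_const !iter_mulr_1; congr (_ * _ ^+ _).
by apply: eq_card => v; rewrite !inE.
Qed.

Lemma sum_weight_disjoint (R : realType) (T : finType) (D : {set T}) :
  \sum_(V : {set T} | [disjoint D & V]) weight (1 / 3 : R) V <= (2 / 3) ^+ #|D|.
Proof.
have := @sum_weight_markov R T (1 / 3) (fun V => [disjoint D & V])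
  (fun v => (v \notin D)%:R) (fun=> 1).
move=> /(_ _ _ _ _) /le_trans; apply.
- by apply/andP; split; lra.
- by move=> v.
- by move=> v; apply: ler01.
- move=> V /pred0P DV; rewrite big1 // => v _; case: ifP => // vV.
  by have := DV v; rewrite /= vV andbT => ->.
rewrite (eq_bigr (fun v => if v \in D then 2 / 3 else 1)).
  by rewrite prod_if_mem expr1n mulr1.
by move=> v _; case: (v \in D) => /=; lra.
Qed.

(* Markov for 2^(|V \ A| - |V /\ A|), whose mean is (5/6)^|A| (4/3)^|~A|; the
   base 25/27 is (5/6)^2 (4/3). *)
Lemma sum_weight_minority (R : realType) (T : finType) (A : {set T}) :
  (2 * #|T| < 3 * #|A|)%N ->
  \sum_(V : {set T} | (#|V :&: A| <= #|V :\: A|)%N) weight (1 / 3 : R) V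
    <= (25 / 27) ^+ (#|A| - #|~: A|).
Proof.
move=> A3.
have := @sum_weight_markov R T (1 / 3) (fun V => (#|V :&: A| <= #|V :\: A|)%N)
  (fun v => if v \in A then 1 / 2 else 2) (fun=> 1).
move=> /(_ _ _ _ _) /le_trans; apply.
- by apply/andP; split; lra.
- by move=> v; case: ifP => _; lra.
- by move=> v; apply: ler01.
- move=> V VA.
  rewrite -big_mkcond /= (bigID (mem A)) /=.
  rewrite (eq_bigr (fun=> 1 / 2)); last by move=> v /andP[_ ->].
  rewrite [X in _ * X](eq_bigr (fun=> 2)); last by move=> v /andP[_ /negbTE ->].
  rewrite !big_const !iter_mulr_1.
  rewrite (_ : #|(fun i : T => _ && (i \in A))| = #|V :&: A|); last first.
    by apply: eq_card => v; rewrite !inE.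
  rewrite (_ : #|(fun i : T => _ && (i \notin A))| = #|V :\: A|); last first.
    by apply: eq_card => v; rewrite !inE andbC.
  rewrite div1r exprVn mulrC ler_pdivlMr ?exprn_gt0 // mul1r.
  by rewrite ler_eXn2l // ltr1n.
rewrite (eq_bigr (fun v => if v \in A then 5 / 6 else 4 / 3)); last first.
  by move=> v _; case: (v \in A) => /=; lra.
rewrite prod_if_mem.
have := cardsC A; set a := #|A|; set b := #|~: A| => cA.
(* As a > 2b, pair two vertices of [A] with each one outside; the other a - 2b contribute 5/6 <=
   25/27 each. *)
have -> : a = (2 * b + (a - 2 * b))%N by lia.
set c := (a - 2 * b)%N.
have -> : (2 * b + c - b = b + c)%N by lia.
rewrite (exprD _ (2 * b)) exprM (exprD _ b) mulrAC -exprMn; apply: ler_pM => //; rewrite ?exprn_ge0 //; try lra.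
  by apply: lerXn2r; rewrite ?nnegrE; lra.
by apply: lerXn2r; rewrite ?nnegrE; lra.
Qed.

(** The binomial theorem in subset form: a union bound over all sets is cheap when each element
    costs a small factor [y]. *)
Lemma sum_powerset_expr (R : realType) (T : finType) (E : {set T}) (y : R) :
  \sum_(F : {set T} | F \subset E) y ^+ #|F| = (1 + y) ^+ #|E|.
Proof.
rewrite -[RHS]mulr1 -[in X in _ * X](expr1n _ #|~: E|) -prod_if_mem.
rewrite (eq_bigr (fun v => (if v \in E then y else 0) + 1)); last first.
  by move=> v _; case: ifP; rewrite ?add0r // addrC.
rewrite bigA_distr big_mkcond /=; apply: eq_bigr => F _.
case: ifP => [/subsetP FE|/subsetPn[x xF xE]].
  rewrite -[LHS]mulr1 -[in X in _ * X](expr1n _ #|~: F|) -prod_if_mem.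
  by apply: eq_bigr => v _; case: ifP => // /FE ->.
by rewrite (bigD1 x) //= xF (negbTE xE) mul0r.
Qed.

Lemma expr_1Dx_le2 (R : realType) (y : R) m : 0 <= y -> 2 * m%:R * y <= 1 -> (1 + y) ^+ m <= 2.
Proof.
move=> y0 my.
(* This linear bound is inductive: the extra term [2 * k%:R * y * y] is at most [y]. *)
suff H k : (k <= m)%N -> (1 + y) ^+ k <= 1 + 2 * k%:R * y.
  by apply: le_trans (H m (leqnn m)) _; lra.
elim: k => [|k IH] km; first by rewrite expr0 mulr0 mul0r addr0.
rewrite exprSr; apply: (@le_trans _ _ ((1 + 2 * k%:R * y) * (1 + y))).
  by apply: ler_wpM2r; [lra|apply: IH; apply: ltnW].
have km' : k%:R <= m%:R :> R by rewrite ler_nat ltnW.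
have k0 : 0 <= k%:R :> R by [].
have : 2 * k%:R * y <= 1.
  by apply: le_trans my; apply: ler_wpM2r => //; lra.
rewrite -natr1; nra.
Qed.

(** * The union bound *)

Lemma prob_subset_union (R : realType) (T I : finType) (q : R) (bad : I -> pred {set T})
    (P : {set T} -> Prop) :
  0 <= q <= 1 -> (forall V : {set T}, (forall i, ~~ bad i V) -> P V) ->
  1 - \sum_i \sum_(V | bad i V) weight q V <= prob_subset q P.
Proof.
move=> q01 good; rewrite lerBlDr -(sum_weight T q) (bigID (fun V => `[< P V >])) /=.
rewrite /prob_subset lerD2l (exchange_big_dep xpredT) //=.
rewrite [leRHS](bigID (fun V => `[< P V >])) /= -[leLHS]add0r; apply: lerD.
  by apply: sumr_ge0 => V _; apply: sumr_ge0 => i _; apply: weight_ge0.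
apply: ler_sum => V /asboolPn nPV.
have [i Vi] : exists i, bad i V.
  by apply/existsP; apply: contra_notT nPV; rewrite negb_exists => /forallP; apply: good.
by rewrite (bigD1 i) //= lerDl; apply: sumr_ge0 => j _; apply: weight_ge0.
Qed.

(** The size conditions give [K * w <= 5 * #|A|] for the total code size [w], so both alternatives
    have probability at most 16^(-kw). For n < 2^k each coded element thus costs less than
    n^(-4). *)
Lemma prob_bad_sample (R : realType) (G : sgraph) (h K k : nat) (U S S' : {set G})
    (F : {set {set G}}) i :
  (160 * h * k <= K)%N -> (400 * k <= K)%N ->
  \sum_(V | bad_sample h K U F S S' i V) weight (1 / 3 : R) V <=
  if F \subset edges G
  then 2 * ((1 / 16) ^+ k) ^+ (#|U| + #|F| + #|S| + #|S'| + 1) else 0.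
Proof.
move=> Kh Kk; set w := (_ + 1)%N; rewrite /bad_sample.
set A := layer _ _ _ _; set D := blocked _ _ _ _.
case: ifP => [FE|_]; last by rewrite big1.
case: (boolP [&& K * #|U| <= #|A|, K * #|F| <= #|A|, K * #|S| <= #|A|,
               K * #|S'| <= #|A| & K <= #|A|]%N) => [/and5P[KU KF KS KS' KA]|adm]; last first.
  rewrite big_pred0 ?mulr_ge0 ?exprn_ge0 // ?div1r ?invr_ge0 // => V.
  by apply: contraNF adm => /and5P[_ -> -> -> /and3P[-> ->]].
have Kw : (K * w <= 5 * #|A|)%N by rewrite /w; lia.
have y0 : 0 <= 1 / 16 :> R by lra.
have w0 (V : {set G}) : 0 <= weight (1 / 3 : R) V by apply: weight_ge0; apply/andP; split; lra.
apply: (@le_trans _ _ (\sum_(V : {set G} | (#|A| <= 4 * h * #|D|)%N && [disjoint D & V]) weight (1 / 3) V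
   + \sum_(V : {set G} | (2 * #|G| < 3 * #|A|)%N && (#|V :&: A| <= #|V :\: A|)%N) weight (1 / 3) V)).
  rewrite [X in _ <= X + _]big_mkcond [X in _ <= _ + X]big_mkcond -big_split big_mkcond.
  apply: ler_sum => V _; rewrite KU KF KS KS' KA /=.
  case: (_ && [disjoint D & V]) => /=; case: ((2 * #|G| < 3 * #|A|)%N && _); by rewrite ?addr0 ?add0r ?lerDl.
rewrite mulr_natl mulr2n -exprM; apply: lerD.
  case: leqP => [AD|_] /=; last by rewrite big1 // exprn_ge0.
  apply: le_trans (sum_weight_disjoint R D) _.
  (* The 8 is chosen because (2/3)^8 <= 1/16. *)
  have D8 : (8 * (k * w) <= #|D|)%N.
    have [h0|h0] := posnP h.
      by move: AD; rewrite h0 muln0 mul0n => AD; have -> : k = 0%N by lia.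
    rewrite -(@leq_pmul2l (20 * h)) ?muln_gt0 //.
    have := leq_mul Kh (leqnn w); move=> /leq_trans /(_ Kw).
    by rewrite (mulnA 8) !mulnA; lia.
  apply: (@le_trans _ _ ((2 / 3) ^+ (8 * (k * w)))).
    by apply: ler_wiXn2l D8; lra.
  by rewrite exprM; apply: lerXn2r; rewrite ?nnegrE ?exprn_ge0; lra.
case: ltnP => [A3|_] /=; last by rewrite big1 // exprn_ge0.
apply: le_trans (sum_weight_minority R A3) _.
(* As [A] exceeds two thirds of the vertices, the difference exceeds [#|A|] / 2, hence K w / 10. *)
have A40 : (40 * (k * w) <= #|A| - #|~: A|)%N.
  have := cardsC A; have := leq_mul Kk (leqnn w); nia.
apply: (@le_trans _ _ ((25 / 27) ^+ (40 * (k * w)))).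
  by apply: ler_wiXn2l A40; lra.
rewrite exprM; apply: lerXn2r; rewrite ?nnegrE ?exprn_ge0 //; first by lra.
(* In turn, (25/27)^5 <= 7/10, (7/10)^2 <= 1/2 and (1/2)^4 = 1/16. *)
rewrite (_ : 40 = 5 * 2 * 4)%N // 2!exprM.
apply: (@le_trans _ _ ((1 / 2) ^+ 4)); last by lra.
apply: lerXn2r; rewrite ?nnegrE ?exprn_ge0 //; [lra|lra|].
apply: (@le_trans _ _ ((7 / 10) ^+ 2)); last by lra.
by apply: lerXn2r; rewrite ?nnegrE ?exprn_ge0 //; lra.
Qed.

Lemma card_edges (G : sgraph) : (#|edges G| <= #|G| ^ 2)%N.
Proof.
apply: leq_trans (leq_imset_card _ _) _; apply: leq_trans (max_card _) _.
by rewrite card_prod.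
Qed.

(** The sum factors: three vertex sets and one edge set contribute at most 2 each, and [j]
    contributes n. The [+ 1] in the exponent supplies a spare factor [y] <= n^(-4), leaving 32 n
    y. *)
Lemma sum_codes (R : realType) (G : sgraph) (k : nat) :
  (#|G| < 2 ^ k)%N -> (1 < #|G|)%N ->
  \sum_(j < #|G|) \sum_(F : {set {set G}} | F \subset edges G) \sum_(U : {set G})
    \sum_(S : {set G}) \sum_(S' : {set G})
      2 * ((1 / 16 : R) ^+ k) ^+ (#|U| + #|F| + #|S| + #|S'| + 1)
  <= 32 / #|G|%:R ^+ 3.
Proof.
move=> nk n2.
have bound32 (t e m z : R) : 0 <= t -> t <= 2 -> 0 <= e -> e <= 2 -> 0 <= m ->
    0 <= z -> m ^+ 4 * z <= 1 -> m * (2 * z * t ^+ 3 * e) * m ^+ 3 <= 32.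
  move=> t0 t2 e0 e2 m0 z0 z1.
  have t3 : t ^+ 3 <= 8.
    by rewrite (_ : 8 = 2 ^+ 3); [apply: lerXn2r; rewrite ?nnegrE|lra].
  have te : t ^+ 3 * e <= 8 * 2 by apply: ler_pM => //; apply: exprn_ge0.
  rewrite [leLHS](_ : _ = m ^+ 4 * z * (2 * (t ^+ 3 * e))); last by ring.
  rewrite -[leRHS]mul1r; apply: ler_pM => //; last by lra.
    by apply: mulr_ge0 => //; apply: exprn_ge0.
  by apply: mulr_ge0 => //; apply: mulr_ge0 => //; apply: exprn_ge0.
set n := #|G|; set y := (1 / 16) ^+ k.
have y0 : 0 <= y by rewrite exprn_ge0 //; lra.
have {}n2 : 2 <= n%:R :> R by rewrite ler_nat.
have yn : n%:R ^+ 4 * y <= 1.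
  rewrite /y div1r exprVn ler_pdivrMr ?exprn_gt0 // mul1r.
  rewrite (_ : 16 = 2 ^+ 4 :> R); last by lra.
  rewrite -exprM mulnC exprM -(natrX _ 2).
  by apply: lerXn2r; rewrite ?nnegrE // ler_nat ltnW.
have yn2 : 2 * (n ^ 2)%:R * y <= 1.
  apply: le_trans yn; apply: ler_wpM2r => //; rewrite natrX.
  rewrite (_ : n%:R ^+ 4 = n%:R ^+ 2 * n%:R ^+ 2); last by rewrite -exprD.
  by apply: ler_wpM2r; nra.
have half_le m : (m <= n ^ 2)%N -> (1 + y) ^+ m <= 2.
  move=> mn; apply: expr_1Dx_le2 => //; apply: le_trans yn2.
  by rewrite ler_wpM2r // ler_wpM2l // ler_nat.
have T2 : (1 + y) ^+ n <= 2 by apply: half_le; rewrite leq_pmull // /n ltnW // -(ltr_nat R); lra.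
have E2 := half_le _ (card_edges G).
have sumT : \sum_(S : {set G}) y ^+ #|S| = (1 + y) ^+ n.
  rewrite /n -cardsT -sum_powerset_expr; apply: eq_bigl => S; exact/esym/subsetT.
rewrite (eq_bigr (fun=> 2 * y * (1 + y) ^+ n ^+ 3 * (1 + y) ^+ #|edges G|)).
  rewrite sumr_const.
  rewrite card_ord.
  rewrite -[leLHS]mulr_natl.
  have n3 : 0 < n%:R ^+ 3 :> R by apply: exprn_gt0; apply: lt_le_trans n2.
  rewrite ler_pdivlMr //.
  have y1 : 0 <= 1 + y by apply: addr_ge0.
  by apply: bound32 => //; apply: exprn_ge0.
move=> j _; rewrite -sum_powerset_expr big_distrr /=; apply: eq_bigr => F _.
rewrite (_ : _ * _ = \sum_(U : {set G}) (y ^+ #|U| * (2 * y * (1 + y) ^+ n ^+ 2 * y ^+ #|F|))); last first.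
  by rewrite -big_distrl /= sumT; move: (_ ^+ n) (y ^+ #|F|) => t f; ring.
apply: eq_bigr => U _.
rewrite (_ : _ * _ = \sum_(S : {set G}) (y ^+ #|S| * (2 * y * (1 + y) ^+ n * y ^+ #|F| * y ^+ #|U|))); last first.
  by rewrite -big_distrl /= sumT; move: (_ ^+ n) (y ^+ #|F|) (y ^+ #|U|) => t f u; ring.
apply: eq_bigr => S _.
rewrite (_ : _ * _ = \sum_(S' : {set G}) (y ^+ #|S'| * (2 * y * y ^+ #|F| * y ^+ #|U| * y ^+ #|S|))); last first.
  by rewrite -big_distrl /= sumT; move: (_ ^+ n) (y ^+ #|F|) (y ^+ #|U|) (y ^+ #|S|) => t f u v; ring.
by apply: eq_bigr => S' _; rewrite !exprD expr1; move: (y ^+ #|F|) (y ^+ #|U|) (y ^+ #|S|) (y ^+ #|S'|) => f u v w; ring.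
Qed.

(** * Integer parameters from real logarithms *)

Lemma trunc_log_log2 (R : realType) n : (0 < n)%N ->
  (trunc_log 2 n)%:R <= log2 (n%:R : R) <= (trunc_log 2 n).+1%:R.
Proof.
move=> n0; have ln20 : 0 < ln (2 : R) by apply: ln_gt0; rewrite ltr1n.
have n0' : 0 < n%:R :> R by rewrite ltr0n.
have pow m : m%:R * ln (2 : R) = ln ((2 ^ m)%:R).
  by rewrite natrX lnXn // mulr_natl.
apply/andP; split; rewrite /log2.
  rewrite ler_pdivlMr // pow ler_ln ?posrE ?ltr0n ?expn_gt0 // ler_nat.
  exact: trunc_logP.
rewrite ler_pdivrMr // pow ler_ln ?posrE ?ltr0n ?expn_gt0 // ler_nat ltnW //.
exact: trunc_log_ltn.
Qed.

(** All rounding is on the safe side: the deletion budget uses [l], below the logarithm, and the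
    expansion rate uses [l.+1], above it. *)
Lemma nat_expander_of_expander (R : realType) (G : sgraph) (eps s : R) (l : nat) :
  expander G eps s -> 2 ^- 9 <= eps -> l%:R <= log2 (#|G|%:R : R) <= l.+1%:R ->
  2 * log2 (#|G|%:R : R) ^+ 24 <= s -> (0 < l)%N ->
  nat_expander G (l ^ 24) (2 ^ 9 * l.+1 ^ 2).
Proof.
set L := log2 _ => Gexp eps9 /andP[lL Ll] Ls l0 U F FE U0 U3 FU.
have l0' : 0 < l%:R :> R by rewrite ltr0n.
have L0 : 0 < L by apply: lt_le_trans lL.
have U3' : #|U|%:R <= 2 / 3 * #|G|%:R :> R.
  have : (3 * #|U|)%:R <= (2 * #|G|)%:R :> R by rewrite ler_nat.
  by rewrite !natrM; lra.
have FU' : #|F|%:R <= s * #|U|%:R.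
  apply: (@le_trans _ _ ((2 * l ^ 24 * #|U|)%:R)); first by rewrite ler_nat.
  rewrite natrM natrM natrX; apply: ler_wpM2r => //; apply: le_trans Ls.
  by apply: ler_wpM2l => //; apply: lerXn2r; rewrite ?nnegrE // ltW.
have := Gexp U F FE U0 U3' FU'.
set N := #|neighbours _|; rewrite -/L ler_pdivrMr ?exprn_gt0 // => H.
rewrite -(ler_nat R) natrM natrM !natrX.
have H1 : 2 ^- 9 * #|U|%:R <= N%:R * L ^+ 2.
  by apply: le_trans H; apply: ler_wpM2r.
have H2 : N%:R * L ^+ 2 <= N%:R * l.+1%:R ^+ 2.
  by apply: ler_wpM2l => //; apply: lerXn2r; rewrite ?nnegrE // ltW.
have := le_trans H1 H2; rewrite mulrC ler_pdivrMr ?exprn_gt0 // => H3.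
by rewrite -[leRHS]mulrA [leRHS]mulrC (mulrC _ N%:R).
Qed.

Lemma prob_sample_expands (R : realType) (n l : nat) (G : sgraph) (eps s : R) :
  #|G| = n -> l = trunc_log 2 n -> (2 ^ 15 <= l)%N ->
  expander G eps s -> 2 ^- 9 <= eps -> 2 * log2 (n%:R : R) ^+ 24 <= s ->
  1 - 32 / (n%:R : R) ^+ 3 <=
  prob_subset (1 / 3) (fun V : {set G} =>
    forall (U : {set G}) (F : {set {set G}}),
      U != finset.set0 -> F \subset edges G ->
      #|F|%:R <= #|U|%:R / log2 (n%:R : R) ^+ 27 ->
      #|V|%:R / 2 <
        #|ball_through (G := del_edges F) (log2 (n%:R : R) ^+ 4) U V|%:R :> R).
Proof.
move=> Gn Dl l15 Gexp eps9 Ls.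
have l0 : (0 < l)%N by apply: leq_trans l15; rewrite expn_gt0.
have n0 : (0 < n)%N by case: (posnP n) Dl l0 => // -> ->; rewrite trunc_log0.
have n1 : (1 < n)%N.
  by rewrite ltn_neqAle n0 andbT; apply: contraTneq l0 => E; rewrite Dl -E trunc_log1.
have lL := trunc_log_log2 R n0; rewrite -Dl in lL.
have nl : (n < 2 ^ l.+1)%N by rewrite Dl trunc_log_ltn.
set L := log2 _ in Ls lL *; have /andP[lL' _] := lL.
have l0' : 0 < l%:R :> R by rewrite ltr0n.
have L0 : 0 < L by apply: lt_le_trans lL'.
(* Since [2 ^ 15 <= l], constants are absorbed into spare powers of [l]. *)
have pow2_le a b : (a <= 15 * b)%N -> (2 ^ a <= l ^ b)%N.
  move=> ab; apply: (@leq_trans ((2 ^ 15) ^ b)); last by case: b ab => // b _; rewrite leq_exp2r.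
  by rewrite -expnM leq_pexp2l.
pose h := (2 ^ 9 * l.+1 ^ 2)%N; pose K := (l ^ 20)%N.
have l1 : (l.+1 <= 2 * l)%N by rewrite mul2n -addnn -addn1 leq_add2l.
have hl : (h <= 2 ^ 11 * l ^ 2)%N.
  by rewrite /h (expnD 2 9 2) -mulnA leq_mul2l -expnMn leq_exp2r // l1 orbT.
have hkl : (h * l.+1 <= 2 ^ 12 * l ^ 3)%N.
  by rewrite (expnD 2 11 1) (expnD l 2 1) mulnACA leq_mul.
have h0 : (0 < h)%N by rewrite muln_gt0 !expn_gt0.
have Gexp' : nat_expander G (l ^ 24) h.
  by apply: (@nat_expander_of_expander R G eps s l) => //; rewrite Gn.
have l_gt1 : (1 < l)%N by apply: leq_trans l15; rewrite (@leq_pexp2l 2 1 15).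
have KM : (0 < K < l ^ 24)%N by rewrite expn_gt0 l0 /= ltn_exp2l.
have Kh : (160 * h * l.+1 <= K)%N.
  rewrite -mulnA; apply: (@leq_trans (2 ^ 8 * (2 ^ 12 * l ^ 3))); first exact: leq_mul.
  rewrite mulnA -expnD /K (expnD l 17 3) leq_mul2r; apply/orP; right.
  exact: pow2_le.
have Kk : (400 * l.+1 <= K)%N.
  apply: leq_trans Kh; rewrite leq_mul2r; apply/orP; right.
  apply: (@leq_trans (160 * 2 ^ 9)); first by [].
  by rewrite leq_mul2l leq_pmulr ?orbT // expn_gt0.
have hK : (8 * h * K <= l ^ 27)%N.
  apply: (@leq_trans (2 ^ 3 * (2 ^ 11 * l ^ 2) * K)); first by rewrite leq_mul2r leq_mul ?orbT.
  rewrite mulnA -expnD -mulnA -expnD (expnD l 5 22) leq_mul2r; apply/orP; right.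
  exact: pow2_le.
have path_len : ((4 * h * l.+1).+1 <= l ^ 4)%N.
  rewrite -mulnA; apply: (@leq_ltn_trans (2 ^ 2 * (2 ^ 12 * l ^ 3))).
    by rewrite leq_mul2l hkl orbT.
  rewrite mulnA -expnD (expnD l 1 3) ltn_mul2r expn_gt0 l0 /=.
  by apply: leq_trans l15; rewrite ltn_exp2l.
pose I := ('I_#|G| * {set {set G}} * {set G} * {set G} * {set G})%type.
pose bad (c : I) (V : {set G}) :=
  bad_sample h K c.1.1.2 c.1.1.1.2 c.1.2 c.2 c.1.1.1.1 V.
apply: le_trans (@prob_subset_union R G I (1 / 3) bad _ _ _); first last.
- move=> V good U F U0 FE FU.
  have FK : (8 * h * K * #|F| <= #|U|)%N.
    apply: leq_trans (leq_mul hK (leqnn _)) _.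
    rewrite -(ler_nat R) natrM natrX mulrC.
    move: FU; rewrite ler_pdivlMr ?exprn_gt0 //; apply: le_trans.
    by apply: ler_wpM2l => //; apply: lerXn2r; rewrite ?nnegrE // ltW.
  have nl' : (#|G| < 2 ^ l.+1)%N by rewrite Gn.
  have n1' : (1 < #|G|)%N by rewrite Gn.
  have [|A [VA reach]] := @good_sample_expands G _ h K l.+1 F U V Gexp' h0 KM FE U0 n1' nl' FK.
    by move=> U' S S' j jG; apply: (good (Ordinal jG, F, U', S, S')).
  apply: (@lt_le_trans _ _ #|V :&: A|%:R).
    rewrite ltr_pdivrMr // -natrM ltr_nat -(cardsID A V) muln2 -addnn.
    by rewrite ltn_add2l.
  rewrite ler_nat; apply: subset_leq_card; apply/subsetP => y /setIP[yV yA].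
  rewrite inE yV; apply/asboolP; have [x [p [xU xp lp pV sp]]] := reach y yA.
  exists x, p; split=> //; apply: (@le_trans _ _ ((l ^ 4)%:R)).
    by rewrite ler_nat (leq_trans sp).
  by rewrite natrX; apply: lerXn2r; rewrite ?nnegrE // ltW.
- by apply/andP; split; lra.
rewrite lerD2l lerN2 -Gn.
have nl' : (#|G| < 2 ^ l.+1)%N by rewrite Gn.
have n1' : (1 < #|G|)%N by rewrite Gn.
apply: le_trans (sum_codes R nl' n1').
pose p (j : 'I_#|G|) (F : {set {set G}}) (U S1 S2 : {set G}) : R :=
  \sum_(V | bad_sample h K U F S1 S2 j V) weight (1 / 3) V.
(* The sum over tuples is unfolded into the iterated sums of [sum_codes]. *)
rewrite -(pair_bigA _ (fun c S2 => p c.1.1.1 c.1.1.2 c.1.2 c.2 S2)) /=.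
rewrite -(pair_bigA _ (fun c S1 => \sum_S2 p c.1.1 c.1.2 c.2 S1 S2)) /=.
rewrite -(pair_bigA _ (fun c U => \sum_S1 \sum_S2 p c.1 c.2 U S1 S2)) /=.
rewrite -(pair_bigA _ (fun j F => \sum_U \sum_S1 \sum_S2 p j F U S1 S2)) /=.
apply: ler_sum => j _; rewrite [leRHS]big_mkcond; apply: ler_sum => F _.
case: ifP => FE.
  do 3!apply: ler_sum => ? _.
  by apply: le_trans (prob_bad_sample _ _ _ _ _ _ Kh Kk) _; rewrite FE.
rewrite big1 // => U _; rewrite big1 // => S1 _; rewrite big1 // => S2 _.
apply/eqP; rewrite eq_le; apply/andP; split.
  by apply: le_trans (prob_bad_sample _ _ _ _ _ _ Kh Kk) _; rewrite FE.
by apply: sumr_ge0 => V _; apply: weight_ge0; apply/andP; split; lra.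
Qed.

Theorem lemma19 (R : realType) :
  exists delta : nat -> R,
    [/\ forall n, 0 <= delta n <= 1,
        (fun n : nat => n%:R * delta n) @ \oo --> (0 : R)
      & forall (n : nat) (G : sgraph) (eps s : R),
          #|G| = n ->
          expander G eps s ->
          2 ^- 9 <= eps <= 1 ->
          2 * log2 (n%:R : R) ^+ 24 <= s ->
          1 - delta n <=
            prob_subset (1 / 3) (fun V : {set G} =>
              forall (U : {set G}) (F : {set {set G}}),
                U != finset.set0 ->
                F \subset edges G ->
                #|F|%:R <= #|U|%:R / log2 (n%:R : R) ^+ 27 ->
                #|V|%:R / 2 <
                  #|ball_through (G := del_edges F) (log2 (n%:R : R) ^+ 4) U V|%:R :> R)].
Proof.
(* t hides the threshold: 2 ^ t must never be evaluated. *)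
have [t Dt] : exists t, t = (2 ^ 15)%N by exists (2 ^ 15)%N.
(* Below the threshold the bound is trivial; above it n times delta is the harmonic sequence
   1/(n+1). *)
exists (fun n => if (trunc_log 2 n < t)%N then 1 else (n%:R * n.+1%:R)^-1); split.
- move=> n; case: ifP => _; first by rewrite ler01 lexx.
  rewrite invr_ge0 mulr_ge0 //=; case: n => [|n]; first by rewrite mul0r invr0.
  by rewrite invf_le1 -natrM ?ltr0n // ler1n.
- apply: cvg_trans (@cvg_harmonic R); apply: near_eq_cvg; near=> n.
  have nt : (2 ^ t <= n)%N by near: n; exact: nbhs_infty_ge.
  have n0 : n%:R != 0 :> R.
    by rewrite pnatr_eq0 -lt0n (leq_trans _ nt) // expn_gt0.
  by rewrite ltnNge trunc_log_max //= invfM mulrA divff // mul1r.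
move=> n G eps s Gn Gexp /andP[eps9 _] Ls.
case: ltnP => [_|lt].
  rewrite subrr; apply: sumr_ge0 => V _; apply: weight_ge0; apply/andP; split; lra.
rewrite Dt in lt.
apply: le_trans (prob_sample_expands Gn (erefl _) lt Gexp eps9 Ls).
rewrite lerD2l lerN2.
(* This ensures 32 (n + 1) <= n^2, that is, 32/n^3 <= 1/(n(n+1)). *)
have n64 : 64 <= n%:R :> R.
  have -> : 64 = (2 ^ 6)%:R :> R by [].
  rewrite ler_nat; have n0 : (0 < n)%N.
    by case: (posnP n) lt => // ->; rewrite trunc_log0 leqn0 expn_eq0.
  apply: leq_trans (trunc_logP (isT : 1 < 2)%N n0); rewrite leq_exp2l //.
  by apply: leq_trans (leq_trans (isT : 6 <= 2 ^ 3)%N _) lt; rewrite leq_exp2l.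
have n0 : 0 < n%:R :> R by lra.
rewrite -[n.+1%:R]natr1; move: (n%:R : R) n64 n0 => x x64 x0.
rewrite ler_pdivrMr ?exprn_gt0 // [leRHS]mulrC ler_pdivlMr ?mulr_gt0 ?addr_gt0 //.
rewrite exprS mulrCA ler_pM2l // expr2; nra.
Unshelve. all: by end_near.
Qed.
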